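(* Let $\mathbf g\in\mathbb{R}^d$ have non-zero entries and $\epsilon>0$, and let $$\mathsf{RN}(\mathbf{x})=\frac{\mathbf{g}\odot\mathbf{x}}{\sqrt{\|\mathbf{x}\|_2^2+\epsilon}},\qquad \mathsf{LN}(\mathbf{x})=\mathsf{RN}\big((\mathbf{I}_d-\tfrac1d\mathbf{1}\mathbf{1}^\top)\mathbf{x}\big),\qquad\mathbf{x}\in\mathbb{R}^d.$$ For every $\mathbf{x}\in\mathbb{R}^d$, the value of $\mathsf{RN}(\mathbf{x})$ computed in floating-point arithmetic satisfies (entrywise) $$|\mathsf{fl}(\mathsf{RN}(\mathbf{x}))-\mathsf{RN}(\mathbf{x})|\le\Big(\tfrac72\mathsf{u}_w+\tfrac12\gamma_{MM}(d,\mathsf{u}_w)+\mathcal{O}(\mathsf{u}_w^2)\Big)|\mathsf{RN}(\mathbf{x})|.$$ If the mean-centred vector $\mathbf{y}=(\mathbf{I}_d-\tfrac1d\mathbf{1}\mathbf{1}^\top)\mathbf{x}$ is non-zero, the value of $\mathsf{LN}(\mathbf{x})$ computed in floating-point arithmetic satisfies (entrywise) $$|\mathsf{fl}(\mathsf{LN}(\mathbf{x}))-\mathsf{LN}(\mathbf{x})|\le\Big(\tfrac72\mathsf{u}_w+\tfrac12\gamma_{MM}(d,\mathsf{u}_w)+\mathcal{O}(\mathsf{u}_w^2)\Big)|\mathsf{LN}(\mathbf{x})|+\kappa_{\infty,\infty}(\mathsf{RN},\mathbf{y})\bigg(\mathsf{u}_w+\big(\mathsf{u}_w+\gamma_{M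M}(d,\mathsf{u}_w)\big)\frac{\|\mathbf{x}\|_1}{d\|\mathbf{y}\|_\infty}\bigg)\|\mathsf{LN}(\mathbf{x})\|_\infty\mathbf{1}.$$
   Context: $\odot$ is the entrywise product, $\mathbf 1$ the all-ones vector; absolute values and inequalities of vectors are entrywise. $\kappa_{\infty,\infty}(\mathsf{RN},\mathbf{y})=\|\mathbf J_{\mathsf{RN}}(\mathbf y)\|_{\infty,\infty}\|\mathbf y\|_\infty/\|\mathsf{RN}(\mathbf y)\|_\infty$ is the relative $\ell_\infty$-normwise condition number ($\mathbf J_{\mathsf{RN}}$ is the Jacobian, $\|\cdot\|_{\infty,\infty}$ the $\ell_\infty\to\ell_\infty$ operator norm). Floating-point model, working precision with unit round-off $\mathsf{u}_w$: every arithmetic operation ($+,-,\times,/$) and every square root returns the exact result for its actual operands multiplied by $1+\delta$, $|\delta|\le\mathsf{u}_w$. Summations are performed by a fixed algorithm with error constant $\gamma_{MM}(d,\mathsf{u}_w)\ge0$, a quantity of first order in $\mathsf{u}_w$ (for recursive summation $\gamma_{MM}(d,\mathsf u)=d\mathsf u/(1-d\mathsf u)$): a computed sum satisfies $|\mathsf{fl}(\sum_{i=1}^dx_i)-\sum_ix_i|\le\gamma_{MM}(d,\mathsf{u}_w)\|\mathbf{x}\|_1$, and $|\mathsf{fl}(\|\mathbf{x}\|_2^2+\epsilon)-(\|\mathbf{x}\|_2^2+\epsilon)|\le\mathsf{u}_w\epsilon+\gamma_{MM}(d,\mathsf{u}_w)\|\mathbf{x}\|_2^2$. Algorithms: $\mathsf{RN}(\mathbf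 x)$ is evaluated by computing $\|\mathbf{x}\|_2^2+\epsilon$, its square root, the product $\mathbf{g}\odot\mathbf{x}$, and the entrywise division. $\mathsf{LN}(\mathbf x)$ is evaluated by computing the sum of the entries of $\mathbf x$, dividing it by $d$, subtracting the result from every entry of $\mathbf{x}$ (giving the computed $\hat{\mathbf y}$), and applying the $\mathsf{RN}$ algorithm to $\hat{\mathbf{y}}$. $\mathsf{fl}(\cdot)$ denotes the computed value. $\mathcal{O}(\mathsf{u}_w^2)$ is understood as $\mathsf{u}_w\to0$ with the data ($d,\mathbf x,\mathbf g,\epsilon$) fixed. *)

(* Defs.v *)
From HB Require Import structures.
From mathcomp Require Import all_boot all_order all_algebra.
From mathcomp Require Import all_classical all_reals all_analysis.

Set Implicit Arguments.
Unset Strict Implicit.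
Unset Printing Implicit Defensive.
Import Order.TTheory GRing.Theory Num.Theory.
Import numFieldNormedType.Exports.

Local Open Scope classical_set_scope.
Local Open Scope ring_scope.

(* Vectors of R^d are row vectors, as required by the library's Jacobian; the
   library norm `|x| of a row or column vector is its l_infinity norm. *)
Section defs.
Context {R : realType}.

Definition norm1 d (x : 'rV[R]_d) : R := \sum_i `|x 0 i|.

Definition sqnorm2 d (x : 'rV[R]_d) : R := \sum_i x 0 i ^+ 2.

Definition RN d (g : 'rV[R]_d) (eps : R) (x : 'rV[R]_d) : 'rV[R]_d :=
  \row_i (g 0 i * x 0 i / Num.sqrt (sqnorm2 x + eps)).

Definition ones d : 'rV[R]_d := const_mx 1.

(* The centring matrix is symmetric, so it may act on row vectors. *)
Definition mean_center d (x : 'rV[R]_d) : 'rV[R]_d :=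
  x *m (1%:M - d%:R^-1 *: ((ones d)^T *m ones d)).

Definition LN d (g : 'rV[R]_d) (eps : R) (x : 'rV[R]_d) : 'rV[R]_d :=
  RN g eps (mean_center x).

Definition opnorm_oo m n (A : 'M[R]_(m, n)) : R :=
  sup [set `|A *m v| | v in [set v : 'cV[R]_n | `|v| <= 1]].

(* The library's 'J f y acts on row vectors from the right; its transpose is
   the usual Jacobian matrix, with entries d f_i / d y_j. *)
Definition cond_oo m n (f : 'rV[R]_n -> 'rV[R]_m) (y : 'rV[R]_n) : R :=
  opnorm_oo ('J f y)^T * `|y| / `|f y|.

(* Floating-point computations are described by the relation between their
   inputs and the values they may return: every execution of an operation has
   its own rounding error, constrained only by the error model. *)

(* b is a possible computed value of an operation with exact result a *)
Definition fl_op (u a b : R) : Prop :=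
  exists2 delta : R, `|delta| <= u & b = a * (1 + delta).

Definition fl_sum (gam : R) d (x : 'rV[R]_d) (s : R) : Prop :=
  `|s - \sum_i x 0 i| <= gam * norm1 x.

Definition fl_sqnorm2_eps (u gam eps : R) d (x : 'rV[R]_d) (s : R) : Prop :=
  `|s - (sqnorm2 x + eps)| <= u * eps + gam * sqnorm2 x.

(* When eps > 0, u < 1 and gam < 1 the model forces s > 0 and r > 0, so the
   conventions for square roots of negative numbers and division by 0 do not
   matter for small u. *)
Definition fl_RN (u gam : R) d (g : 'rV[R]_d) (eps : R) (x z : 'rV[R]_d) :
    Prop :=
  exists (s r : R) (p : 'rV[R]_d),
    [/\ fl_sqnorm2_eps u gam eps x s,
        fl_op u (Num.sqrt s) r,
        forall i, fl_op u (g 0 i * x 0 i) (p 0 i)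
      & forall i, fl_op u (p 0 i / r) (z 0 i)].

Definition fl_LN (u gam : R) d (g : 'rV[R]_d) (eps : R) (x z : 'rV[R]_d) :
    Prop :=
  exists (s m : R) (yhat : 'rV[R]_d),
    [/\ fl_sum gam x s,
        fl_op u (s / d%:R) m,
        forall i, fl_op u (x 0 i - m) (yhat 0 i)
      & fl_RN u gam g eps yhat z].

End defs.

(* Main.v *)
Require Import Defs.
From HB Require Import structures.
From mathcomp Require Import all_boot all_order all_algebra.
From mathcomp Require Import all_classical all_reals all_analysis.
From mathcomp Require Import ring lra.

(** In RN every rounding error is relative, and the one in the sum under the
    square root is halved by the square root.  For LN, the centring step returns
    y + D with D of first order in u, and a second-order Taylor expansion gives
    RN(y + D) = RN(y) + J D + O(|D|^2), where J D is bounded by the operator norm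
    of J.  The second-order remainder has to be absorbed entrywise: where y_i is
    non-zero it is a multiple of LN(x)_i.  Where y_i = 0, LN(x)_i vanishes too,
    but then the rounding of x_i - m contributes no error of order u |y|, and the
    unused positive first-order term kappa u |LN(x)| dominates the remainder. *)

Set Implicit Arguments.
Unset Strict Implicit.
Unset Printing Implicit Defensive.
Import Order.TTheory GRing.Theory Num.Theory.
Import numFieldNormedType.Exports.

Local Open Scope classical_set_scope.
Local Open Scope ring_scope.

(** * The operator norm induced by the maximum norm *)

Section operator_norm.
Context {R : realType}.

Lemma mx_entry_le_norm m n (A : 'M[R]_(m, n)) i j : `|A i j| <= `|A|.
Proof.
rewrite [`|A|]mx_normrE.
exact: (le_bigmax _ (fun ij : 'I_m * 'I_n => `|A ij.1 ij.2|) (i, j)).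
Qed.

Lemma mx_norm_le m n (A : 'M[R]_(m, n)) (c : R) :
  0 <= c -> (forall i j, `|A i j| <= c) -> `|A| <= c.
Proof.
by move=> c0 Ac; rewrite [`|A|]mx_normrE; apply: bigmax_le => // ij _; exact: Ac.
Qed.

(** A crude bound by the sum of all entries. It shows that the set defining [opnorm_oo] is bounded,
    so that its supremum is meaningful, and later that a matrix acts continuously. *)
Lemma mulmx_norm_le m n (A : 'M[R]_(m, n)) (v : 'cV[R]_n) :
  `|A *m v| <= (\sum_i \sum_j `|A i j|) * `|v|.
Proof.
have sum0 i : 0 <= \sum_j `|A i j| by exact: sumr_ge0.
apply: mx_norm_le => [|i j]; first by rewrite mulr_ge0 ?normr_ge0 ?sumr_ge0.
rewrite mxE; apply: (le_trans (ler_norm_sum _ _ _)).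
apply: (@le_trans _ _ (\sum_k `|A i k| * `|v|)).
  by apply: ler_sum => k _; rewrite normrM ler_wpM2l ?mx_entry_le_norm.
rewrite -mulr_suml ler_wpM2r //.
by rewrite (bigD1 i) //= lerDl sumr_ge0.
Qed.

Lemma opnorm_oo_ub m n (A : 'M[R]_(m, n)) (v : 'cV[R]_n) :
  `|v| <= 1 -> `|A *m v| <= opnorm_oo A.
Proof.
move=> v1; apply: ub_le_sup; last by exists v.
exists (\sum_i \sum_j `|A i j|) => _ [w /= w1 <-].
apply: (le_trans (mulmx_norm_le _ _)); apply: ler_piMr => //.
by apply: sumr_ge0 => i _; exact: sumr_ge0.
Qed.

Lemma mulmx_opnorm_oo m n (A : 'M[R]_(m, n)) (v : 'cV[R]_n) :
  `|A *m v| <= opnorm_oo A * `|v|.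
Proof.
have [->|v0] := eqVneq v 0; first by rewrite mulmx0 !normr0 mulr0.
have nv0 : 0 < `|v| by rewrite normr_gt0.
rewrite -ler_pdivrMr //.
have := @opnorm_oo_ub _ _ A (`|v|^-1 *: v).
rewrite -scalemxAr !normrZ normfV normr_id mulVf ?gt_eqF // lexx => /(_ isT).
by rewrite mulrC.
Qed.

(** Column [j] is the image of a basis vector of norm at most 1. Diagonal entries will serve to show
    that the norm of the Jacobian is non-negative, and even positive. *)
Lemma entry_le_opnorm_oo m n (A : 'M[R]_(m, n)) i j : `|A i j| <= opnorm_oo A.
Proof.
have := @mulmx_opnorm_oo _ _ A (delta_mx j 0).
rewrite -colE => /(le_trans (mx_entry_le_norm _ i 0)); rewrite mxE.
have d1 : `|(delta_mx j 0 : 'cV[R]_n)| <= 1.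
  by apply: mx_norm_le => // k l; rewrite mxE; case: (_ && _); rewrite ?normr1 ?normr0.
move/le_trans; apply; apply: ler_piMr => //.
by apply: le_trans (opnorm_oo_ub A (v := 0) _); rewrite ?normr0.
Qed.

End operator_norm.

(** * Accumulation of rounding errors in RN *)

Section rounding.
Context {R : realType}.
Implicit Types u gam tau eps : R.

Lemma relative_error_mul (a b e1 e2 e : R) : 0 <= e1 ->
  `|a - 1| <= e1 -> `|b - 1| <= e2 -> e1 + e2 + e1 * e2 <= e ->
  `|a * b - 1| <= e.
Proof.
move=> e10 ha hb; apply: le_trans.
have -> : a * b - 1 = (a - 1) + (b - 1) + (a - 1) * (b - 1) by ring.
by rewrite (le_trans (ler_normD _ _))// normrM lerD ?ler_pM//
  (le_trans (ler_normD _ _))// lerD.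
Qed.

(** The roundings of the product ([d1]), the square root ([d2]) and the division ([d3]) account for
    [3 * u] of the final [7 / 2 * u]. *)
Lemma rounding_ratio u d1 d2 d3 : u <= 1 / 4 ->
  `|d1| <= u -> `|d2| <= u -> `|d3| <= u ->
  `|(1 + d1) * (1 + d3) / (1 + d2) - 1| <= 3 * u + 8 * u ^+ 2.
Proof.
move=> u4 h1 h2 h3.
have u0 : 0 <= u by exact: le_trans h1.
have d20 : 0 < 1 + d2 by move: h2; rewrite ler_norml; lra.
have -> : (1 + d1) * (1 + d3) / (1 + d2) - 1 =
    (d1 + d3 - d2 + d1 * d3) / (1 + d2) by field; rewrite gt_eqF.
rewrite normrM normfV (gtr0_norm d20) ler_pdivrMr //.
apply: (@le_trans _ _ (3 * u + u ^+ 2)).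
  have : `|d1 * d3| <= u ^+ 2 by rewrite normrM expr2 ler_pM.
  move: h1 h2 h3; rewrite !ler_norml; lra.
(* The coefficient 8 leaves room for the division by [1 + d2 >= 1 - u]. *)
apply: (@le_trans _ _ ((3 * u + 8 * u ^+ 2) * (1 - u))); first by nra.
by apply: ler_wpM2l; [nra | move: h2; rewrite ler_norml; lra].
Qed.

(** With [w = S / s] lying between [1 / (1 + tau)] and [1 / (1 - tau)], both bounds on [Num.sqrt w]
    reduce, after squaring and clearing the denominator, to polynomial inequalities in [tau]. *)
Lemma inv_sqrt_relative_error tau (S s : R) : 0 < S -> 0 <= tau -> tau <= 1 / 4 ->
  `|s - S| <= tau * S ->
  `|Num.sqrt S / Num.sqrt s - 1| <= tau / 2 + tau ^+ 2.
Proof.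
move=> S0 t0 t4; rewrite ler_norml => sS.
have s0 : 0 < s by nra.
rewrite -(sqrtrV (ltW s0)) -(sqrtrM _ (ltW S0)).
set w := S / s.
have w0 : 0 < w by rewrite divr_gt0.
have Sw : S = w * s by rewrite /w divfK ?gt_eqF.
have wlo : 1 <= w * (1 + tau) by rewrite -(ler_pM2r s0); nra.
have whi : w * (1 - tau) <= 1 by rewrite -(ler_pM2r s0); nra.
have q0 : 0 <= Num.sqrt w by exact: sqrtr_ge0.
have q2 : Num.sqrt w ^+ 2 = w by rewrite sqr_sqrtr ?ltW.
move: (Num.sqrt w) q0 q2 => q q0 q2; rewrite -q2 in wlo whi.
have hi : q <= 1 + tau / 2 + tau ^+ 2.
  rewrite -ler_sqr ?nnegrE//; last by nra.
  rewrite -(@ler_pM2r _ (1 - tau)); last by lra.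
  apply: (le_trans whi).
  have -> : (1 + tau / 2 + tau ^+ 2) ^+ 2 * (1 - tau) =
    1 + tau ^+ 2 * (5 / 4 - 5 / 4 * tau - tau ^+ 3) by field.
  rewrite lerDl mulr_ge0 ?sqr_ge0//.
  have : tau ^+ 3 <= tau by rewrite exprS ler_piMr// exprn_ile1//; lra.
  lra.
have lo : 1 - tau / 2 <= q.
  rewrite -ler_sqr ?nnegrE//; last by lra.
  rewrite -(@ler_pM2r _ (1 + tau)); last by lra.
  apply: le_trans wlo.
  have -> : (1 - tau / 2) ^+ 2 * (1 + tau) =
    1 - tau ^+ 2 * (3 / 4 - tau / 4) by field.
  by rewrite gerBl mulr_ge0 ?sqr_ge0//; lra.
have := sqr_ge0 tau.
by rewrite ler_norml; lra.
Qed.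

Lemma sqnorm2_ge0 d (x : 'rV[R]_d) : 0 <= sqnorm2 x.
Proof. by apply: sumr_ge0 => i _; exact: sqr_ge0. Qed.

Lemma fl_RN_error u gam d (g : 'rV[R]_d) eps (x z : 'rV[R]_d) :
  0 < eps -> 0 <= u -> 0 <= gam -> u + gam <= 1 / 4 ->
  fl_RN u gam g eps x z ->
  forall i, `|z 0 i - RN g eps x 0 i| <=
    (7 / 2 * u + 1 / 2 * gam + 16 * (u + gam) ^+ 2) * `|RN g eps x 0 i|.
Proof.
move=> e0 u0 g0 t4 [s [r [p [hs [d2 hd2 ->] hp hz]]]] i.
have [d1 hd1 p1] := hp i; have [d3 hd3 ->] := hz i; rewrite {}p1 mxE.
set S := sqnorm2 x + eps.
have n0 := sqnorm2_ge0 x.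
have S0 : 0 < S by rewrite /S; lra.
(* The errors [u * eps] and [gam * sqnorm2 x] are merged into one relative error [u + gam] of the
   positive sum [S]. *)
have sS : `|s - S| <= (u + gam) * S.
  by apply: (le_trans hs); rewrite /S; nra.
have t0 : 0 <= u + gam by exact: addr_ge0.
have h1 := inv_sqrt_relative_error S0 t0 t4 sS.
have u4 : u <= 1 / 4 by lra.
have h2 := rounding_ratio u4 hd1 hd2 hd3.
have s0 : 0 < s by move: sS; rewrite ler_norml; nra.
have d20 : 0 < 1 + d2 by move: hd2; rewrite ler_norml; lra.
have rS0 : Num.sqrt S != 0 by rewrite sqrtr_eq0 -ltNge.
have rs0 : Num.sqrt s != 0 by rewrite sqrtr_eq0 -ltNge.
set a := g 0 i * x 0 i.
have -> : a * (1 + d1) / (Num.sqrt s * (1 + d2)) * (1 + d3) - a / Num.sqrt S =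
  ((1 + d1) * (1 + d3) / (1 + d2) * (Num.sqrt S / Num.sqrt s) - 1) *
  (a / Num.sqrt S) by field; rewrite rS0 rs0 gt_eqF.
rewrite normrM ler_wpM2r //.
have p0 : 0 <= 3 * u + 8 * u ^+ 2 by exact: le_trans h2.
(* The first-order terms add up to [3 * u + (u + gam) / 2 = 7 / 2 * u + 1 / 2 * gam]. The
   second-order ones are at most [8 + 1 + 5 = 14] times [t ^+ 2], the 5 coming from the product of
   the two errors. *)
apply: (relative_error_mul p0 h2 h1).
set t := u + gam in t0 t4 *.
have ut : u <= t by rewrite /t; lra.
have ut2 : u ^+ 2 <= t ^+ 2 by rewrite ler_sqr ?nnegrE.
have l1 : 3 * u + 8 * u ^+ 2 <= 5 * t by nra.
have l2 : t / 2 + t ^+ 2 <= t by nra.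
have l20 : 0 <= t / 2 + t ^+ 2 by nra.
have : (3 * u + 8 * u ^+ 2) * (t / 2 + t ^+ 2) <= 5 * t * t by exact: ler_pM.
have -> : gam = t - u by rewrite /t; ring.
nra.
Qed.

End rounding.

(** * Second-order Taylor expansion and Jacobian of RN *)

Section RN_differential.
Context {R : realType}.
Implicit Types eps : R.

(** A Lipschitz bound for the inverse square root, in terms of the squares because these will be the
    polynomials [sqnorm2 y + eps] and [sqnorm2 (y + D) + eps]. *)
Lemma inv_sub_le_sqr (e a b : R) : 0 < e -> e <= a -> e <= b ->
  `|b^-1 - a^-1| <= `|b ^+ 2 - a ^+ 2| / e ^+ 3.
Proof.
move=> e0 ea eb.
have a0 : 0 < a by exact: lt_le_trans ea.
have b0 : 0 < b by exact: lt_le_trans eb.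
have -> : b^-1 - a^-1 = - ((b ^+ 2 - a ^+ 2) / (a * b * (a + b))).
  by field; rewrite !gt_eqF ?addr_gt0.
rewrite normrN normrM ler_wpM2l //.
rewrite ger0_norm ?invr_ge0 ?mulr_ge0 ?addr_ge0 ?(ltW a0) ?(ltW b0)//.
rewrite lef_pV2 ?posrE ?exprn_gt0 ?mulr_gt0 ?addr_gt0//.
have ab : e ^+ 2 <= a * b by rewrite expr2 ler_pM ?(ltW e0).
rewrite exprSr ler_pM ?exprn_ge0 ?(ltW e0)//; lra.
Qed.

(** The first-order expansion of the inverse square root at [a ^+ 2], whose derivative there is
    [- 1 / (2 * a ^+ 3)]. The remainder is an explicit rational function, so no calculus is
    involved. *)
Lemma inv_taylor_sqr (e a b : R) : 0 < e -> e <= a -> e <= b ->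
  `|b^-1 - a^-1 + (b ^+ 2 - a ^+ 2) / (2 * a ^+ 3)| <=
  (b ^+ 2 - a ^+ 2) ^+ 2 / e ^+ 5.
Proof.
move=> e0 ea eb.
have a0 : 0 < a by exact: lt_le_trans ea.
have b0 : 0 < b by exact: lt_le_trans eb.
have -> : b^-1 - a^-1 + (b ^+ 2 - a ^+ 2) / (2 * a ^+ 3) =
   (b ^+ 2 - a ^+ 2) ^+ 2 * ((b + 2 * a) / (2 * a ^+ 3 * b * (a + b) ^+ 2)).
  by field; rewrite !gt_eqF ?addr_gt0.
have w0 : 0 < 2 * a ^+ 3 * b * (a + b) ^+ 2.
  by rewrite !mulr_gt0 ?exprn_gt0 ?addr_gt0.
have n0 : 0 <= b + 2 * a by lra.
rewrite ger0_norm; last by rewrite mulr_ge0 ?sqr_ge0 // divr_ge0 // ltW.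
rewrite ler_wpM2l ?sqr_ge0 // ler_pdivrMr // [leRHS]mulrC ler_pdivlMr ?exprn_gt0 //.
have -> : 2 * a ^+ 3 * b * (a + b) ^+ 2 =
  (2 * (a + b)) * (a ^+ 3 * (b * (a + b))) by ring.
apply: ler_pM; rewrite ?exprn_ge0 ?(ltW e0) //; first by lra.
have -> : e ^+ 5 = e ^+ 3 * (e * e) by ring.
apply: ler_pM; rewrite ?exprn_ge0 ?mulr_ge0 ?(ltW e0) //.
  by rewrite lerXn2r ?nnegrE ?(ltW e0) ?(ltW a0).
by apply: ler_pM; rewrite ?(ltW e0) //; lra.
Qed.

Definition dot d (y z : 'rV[R]_d) : R := \sum_i y 0 i * z 0 i.

Lemma norm_trmx m n (A : 'M[R]_(m, n)) : `|A^T| = `|A|.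
Proof.
have le m' n' (B : 'M[R]_(m', n')) : `|B^T| <= `|B|.
  by apply: mx_norm_le => // i j; rewrite mxE mx_entry_le_norm.
by apply/le_anti; rewrite le -{1}(trmxK A) le.
Qed.

Lemma dot_norm_le d (y z : 'rV[R]_d) : `|dot y z| <= d%:R * `|y| * `|z|.
Proof.
apply: (le_trans (ler_norm_sum _ _ _)).
apply: (@le_trans _ _ (\sum_(i < d) `|y| * `|z|)).
  by apply: ler_sum => i _; rewrite normrM ler_pM ?mx_entry_le_norm.
by rewrite sumr_const card_ord -mulrA mulr_natl.
Qed.

Lemma sqnorm2_dot d (y : 'rV[R]_d) : sqnorm2 y = dot y y.
Proof. by apply: eq_bigr => i _; rewrite expr2. Qed.

Lemma sqnorm2D d (y z : 'rV[R]_d) :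
  sqnorm2 (y + z) = sqnorm2 y + (2 * dot y z + sqnorm2 z).
Proof.
rewrite /sqnorm2 /dot mulr_sumr -!big_split /=; apply: eq_bigr => i _.
by rewrite mxE; ring.
Qed.

(* Entry (j, i) is d RN_i / d y_j, the convention of 'J. *)
Definition RN_jacobian d (g : 'rV[R]_d) eps (y : 'rV[R]_d) : 'M[R]_d :=
  let rho := Num.sqrt (sqnorm2 y + eps) in
  \matrix_(j, i) (g 0 i * ((j == i)%:R / rho - y 0 i * y 0 j / rho ^+ 3)).

Lemma mulmx_RN_jacobian d (g : 'rV[R]_d) eps (y D : 'rV[R]_d) i :
  (D *m RN_jacobian g eps y) 0 i =
  g 0 i * (D 0 i / Num.sqrt (sqnorm2 y + eps) -
           y 0 i * dot y D / Num.sqrt (sqnorm2 y + eps) ^+ 3).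
Proof.
rewrite mxE; set rho := Num.sqrt _.
under eq_bigr => j _.
  rewrite mxE -/rho (_ : _ * _ = (if j == i then g 0 i * D 0 i / rho else 0) -
    g 0 i * y 0 i / rho ^+ 3 * (y 0 j * D 0 j)); last first.
    by case: eqP => [->|_]; rewrite ?mul1r ?mul0r; ring.
  over.
rewrite big_split sumrN -mulr_sumr -/(dot y D) -big_mkcond big_pred1_eq /=.
by ring.
Qed.

(** An explicit quadratic remainder, stronger than differentiability: it identifies the Jacobian and
    also bounds the effect of the centring error. Since [eps > 0], the square roots stay above
    [e = Num.sqrt eps]. *)
Lemma RN_taylor d (g : 'rV[R]_d) eps (y : 'rV[R]_d) : 0 < eps ->
  exists2 K, 0 <= K & forall D : 'rV[R]_d, `|D| <= 1 ->
    `|RN g eps (y + D) - RN g eps y - D *m RN_jacobian g eps y| <= K * `|D| ^+ 2.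
Proof.
move=> e0.
set e := Num.sqrt eps; have e_gt0 : 0 < e by rewrite sqrtr_gt0.
pose H : R := 2 * (d%:R * `|y|) + d%:R.
have dn0 : 0 <= d%:R :> R by rewrite ler0n.
have dy0 : 0 <= d%:R * `|y| by rewrite mulr_ge0.
have H0 : 0 <= H by rewrite /H; lra.
have e30 : 0 <= (e ^+ 3)^-1 by rewrite invr_ge0 exprn_ge0 ?ltW.
have e50 : 0 <= (e ^+ 5)^-1 by rewrite invr_ge0 exprn_ge0 ?ltW.
exists (`|g| * (`|y| * (H ^+ 2 / e ^+ 5) + `|y| * (d%:R / e ^+ 3) + H / e ^+ 3)).
  by rewrite mulr_ge0 // !addr_ge0 // ?mulr_ge0 // sqr_ge0.
move=> D D1.
apply: mx_norm_le => [|k i].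
  by rewrite !mulr_ge0 ?sqr_ge0 // !addr_ge0 // !mulr_ge0 // sqr_ge0.
rewrite (ord1 k) mxE [(_ - RN g eps y) _ _]mxE [(- RN g eps y) _ _]mxE.
rewrite [(- (D *m _)) _ _]mxE mulmx_RN_jacobian !mxE.
set S := sqnorm2 y + eps; set S' := sqnorm2 (y + D) + eps.
have eS : eps <= S by rewrite /S lerDr sqnorm2_ge0.
have eS' : eps <= S' by rewrite /S' lerDr sqnorm2_ge0.
have hS : S' - S = 2 * dot y D + sqnorm2 D by rewrite /S' /S sqnorm2D; ring.
have S0 : 0 <= S by lra.
have S'0 : 0 <= S' by lra.
have ea : e <= Num.sqrt S by rewrite ler_sqrt.
have eb : e <= Num.sqrt S' by rewrite ler_sqrt.
have := inv_taylor_sqr e_gt0 ea eb; have := inv_sub_le_sqr e_gt0 ea eb.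
rewrite (sqr_sqrtr S0) (sqr_sqrtr S'0) => T1 T2.
have rS0 : Num.sqrt S != 0 by rewrite gt_eqF // sqrtr_gt0; exact: lt_le_trans eS.
have ra : (Num.sqrt S ^+ 3)^-1 <= (e ^+ 3)^-1.
  rewrite lef_pV2 ?posrE ?exprn_gt0 ?sqrtr_gt0 //; last exact: lt_le_trans eS.
  rewrite lerXn2r ?nnegrE ?sqrtr_ge0 // ler_sqrt //; lra.
have ra0 : 0 <= (Num.sqrt S ^+ 3)^-1 by rewrite invr_ge0 exprn_ge0 ?sqrtr_ge0.
have q0 := sqnorm2_ge0 D.
have qn : sqnorm2 D <= d%:R * `|D| ^+ 2.
  by rewrite expr2 mulrA (le_trans _ (dot_norm_le D D)) // -sqnorm2_dot ler_norm.
have hn : `|S' - S| <= H * `|D|.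
  rewrite hS (le_trans (ler_normD _ _)) // normrM (ger0_norm q0).
  rewrite (ger0_norm (_ : 0 <= 2 :> R)) // /H [leRHS]mulrDl lerD //.
    by rewrite -[leRHS]mulrA ler_wpM2l // dot_norm_le.
  apply: (le_trans qn); rewrite expr2 mulrA ler_piMr // mulr_ge0 //.
rewrite (_ : _ - _ = g 0 i * (y 0 i * ((Num.sqrt S')^-1 - (Num.sqrt S)^-1 +
  (S' - S) / (2 * Num.sqrt S ^+ 3)) +
  - (y 0 i * (sqnorm2 D / 2 * (Num.sqrt S ^+ 3)^-1)) +
  D 0 i * ((Num.sqrt S')^-1 - (Num.sqrt S)^-1))); last first.
  by rewrite hS; move: ((Num.sqrt S')^-1) => b'; field.
rewrite normrM -[leRHS]mulrA ler_pM ?mx_entry_le_norm //.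
rewrite [leRHS]mulrDl [X in _ <= X + _]mulrDl (le_trans (ler_normD _ _)) // lerD //.
  rewrite (le_trans (ler_normD _ _)) // lerD //.
    rewrite normrM -[leRHS]mulrA ler_pM ?mx_entry_le_norm // (le_trans T2) //.
    rewrite [leRHS]mulrAC ler_wpM2r // -exprMn -[leLHS]real_normK ?num_real //.
    by rewrite lerXn2r ?nnegrE // mulr_ge0.
  rewrite normrN normrM -[leRHS]mulrA ler_pM ?mx_entry_le_norm //.
  rewrite ger0_norm ?mulr_ge0 // [leRHS]mulrAC; apply: ler_pM => //; lra.
rewrite normrM [leRHS](_ : _ = `|D| * (H * `|D| / e ^+ 3)); last by ring.
rewrite ler_pM ?mx_entry_le_norm // (le_trans T1) // ler_wpM2r //.
Qed.

Lemma jacobian_RN d (g : 'rV[R]_d) eps (y : 'rV[R]_d) : 0 < eps ->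
  'J (RN g eps) y = RN_jacobian g eps y.
Proof.
move=> e0; have [K K0 KP] := RN_taylor g y e0.
pose A := RN_jacobian g eps y.
suff dRN : 'd (RN g eps) y = mulmxr A :> ('rV[R]_d -> 'rV[R]_d).
  apply/row_matrixP => i; rewrite !rowE mul_rV_lin1.
  exact: (congr1 (fun f : 'rV[R]_d -> 'rV[R]_d => f (delta_mx 0 i)) dRN).
(* Two facts characterise the differential: the linear map is continuous, and the remainder is
   negligible compared with the increment. *)
apply: diff_unique.
  apply: bounded_linear_continuous; apply/linear_boundedP.
  pose B : R := \sum_i \sum_j `|A^T i j|.
  near=> M; move=> v /=.
  have BM : B <= M by near: M; apply: nbhs_pinfty_ge; rewrite num_real.
  rewrite -norm_trmx trmx_mul -(norm_trmx v).
  by apply: (le_trans (mulmx_norm_le _ _)); rewrite ler_wpM2r.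
apply/eqaddoP => e e_gt0.
have K1 : 0 < K + 1 by rewrite ltr_wpDl.
have small c : 0 < c -> \forall D \near (0 : 'rV[R]_d), `|D| <= c by exact: nbhs0_le.
near=> D.
have D1 : `|D| <= 1 by near: D; exact: small.
have De : `|D| <= e / (K + 1) by near: D; apply: small; rewrite divr_gt0.
rewrite (_ : _ D = RN g eps (y + D) - RN g eps y - D *m A); last first.
  by rewrite !fctE /= opprD addrA [y + D]addrC.
apply: (le_trans (KP D D1)); rewrite expr2 mulrA ler_wpM2r //.
rewrite (le_trans (ler_wpM2l K0 De)) // mulrCA ger_pMr //.
by rewrite ler_pdivrMr // mul1r lerDl.
Unshelve. all: by end_near. Qed.

End RN_differential.

(** * Error of the centring step and its propagation through RN *)

Section LN_error.
Context {R : realType}.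
Implicit Types u gam eps : R.

Lemma mean_centerE d (x : 'rV[R]_d) i :
  mean_center x 0 i = x 0 i - (\sum_j x 0 j) / d%:R.
Proof.
rewrite /mean_center mulmxBr mulmx1 -scalemxAr !mxE; congr (_ - _).
rewrite mulrC; congr (_ / _); apply: eq_bigr => j _.
by rewrite !mxE big_ord1 !mxE mulr1 mulr1.
Qed.

(** The final subtraction contributes the entrywise term, which vanishes with the entry of
    [mean_center x]. The error of the computed mean contributes the rest, because the exact mean is
    at most [norm1 x / d%:R] in absolute value. *)
Lemma centring_error u gam d (x yhat : 'rV[R]_d) s m :
  0 <= u -> 0 <= gam -> u + gam <= 1 / 4 ->
  fl_sum gam x s -> fl_op u (s / d%:R) m ->
  (forall i, fl_op u (x 0 i - m) (yhat 0 i)) ->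
  forall i, `|yhat 0 i - mean_center x 0 i| <=
    u * `|mean_center x 0 i| +
    ((u + gam) + 3 * (u + gam) ^+ 2) * (norm1 x / d%:R).
Proof.
move=> u0 g0 t4 hs [e he hm] hy i.
have [e' he' ->] := hy i.
set t := u + gam in t4 *; set N := norm1 x / d%:R.
have d0 : 0 <= (d%:R)^-1 :> R by rewrite invr_ge0 ler0n.
set S := \sum_j x 0 j in hs.
have SN : `|S / d%:R| <= N.
  by rewrite /N normrM (ger0_norm d0) ler_wpM2r //; exact: ler_norm_sum.
have N0 : 0 <= N by exact: le_trans SN.
have sN : `|(s - S) / d%:R| <= gam * N.
  by rewrite /N normrM (ger0_norm d0) mulrA ler_wpM2r.
have mN : `|m - S / d%:R| <= (t + t ^+ 2) * N.
  rewrite hm (_ : _ - _ = S / d%:R * e + (s - S) / d%:R * (1 + e)); last by ring.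
  have e1 : `|1 + e| <= 1 + u by rewrite (le_trans (ler_normD _ _)) // normr1 lerD2l.
  have a1 : `|S / d%:R * e| <= N * u by rewrite normrM ler_pM.
  have a2 : `|(s - S) / d%:R * (1 + e)| <= gam * N * (1 + u) by rewrite normrM ler_pM.
  apply: (le_trans (ler_normD _ _)); apply: (le_trans (lerD a1 a2)).
  have -> : N * u + gam * N * (1 + u) = (t + gam * u) * N by rewrite /t; ring.
  by rewrite ler_wpM2r // lerD2l /t; nra.
rewrite mean_centerE -/S.
rewrite (_ : _ - _ = e' * (x 0 i - S / d%:R) - (m - S / d%:R) * (1 + e')); last by ring.
apply: (le_trans (ler_normB _ _)); rewrite lerD // normrM ?ler_wpM2r //.
have e1 : `|1 + e'| <= 1 + u by rewrite (le_trans (ler_normD _ _)) // normr1 lerD2l.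
apply: (@le_trans _ _ ((t + t ^+ 2) * N * (1 + u))); first by rewrite ler_pM.
rewrite mulrAC ler_wpM2r //.
have t0 : 0 <= t by rewrite /t; lra.
have ut : u <= t by rewrite /t; lra.
have t2 := sqr_ge0 t.
(* This product is [t + 2 * t ^+ 2 + t ^+ 3], whence the coefficient 3. *)
apply: (@le_trans _ _ ((t + t ^+ 2) * (1 + t))); first by rewrite ler_wpM2l; lra.
nra.
Qed.

(** The remainder is still absolute here, with [K] independent of [u], [gam] and [z]. The
    conditional records the gain at zero entries of the centred vector, which later makes room for
    that remainder. *)
Lemma fl_LN_error d (g : 'rV[R]_d) eps (x : 'rV[R]_d) : 0 < eps ->
  exists2 K, 0 <= K & forall u gam (z : 'rV[R]_d),
    0 <= u -> 0 <= gam -> u + gam <= 1 / 4 ->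
    (u + gam) * (`|mean_center x| + 2 * (norm1 x / d%:R)) <= 1 ->
    fl_LN u gam g eps x z -> forall i,
    `|z 0 i - LN g eps x 0 i| <=
      (7 / 2 * u + 1 / 2 * gam) * `|LN g eps x 0 i| +
      opnorm_oo ('J (RN g eps) (mean_center x))^T *
        ((if mean_center x 0 i == 0 then 0 else u * `|mean_center x|) +
         (u + gam) * (norm1 x / d%:R)) + K * (u + gam) ^+ 2.
Proof.
move=> e0; set y := mean_center x; set N := norm1 x / d%:R.
have N0 : 0 <= N by rewrite mulr_ge0 ?invr_ge0 ?sumr_ge0.
have [K0 K00 taylor] := RN_taylor g y e0.
rewrite (jacobian_RN g y e0); set A := RN_jacobian g eps y.
set M := opnorm_oo A^T; set B := `|y| + 2 * N.
have B0 : 0 <= B by rewrite /B addr_ge0 // mulr_ge0.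
have M0 (i : 'I_d) : 0 <= M.
  exact: le_trans (normr_ge0 _) (entry_le_opnorm_oo A^T i i).
(* In order: the second-order term of the RN error, that of the centring error, the Taylor
   remainder, and the RN error (at most [8 * t]) times the perturbation of RN. [M] enters as [|M|]
   because its sign is derived from an index, not yet available. *)
exists (16 * `|LN g eps x| + 3 * (`|M| * N) + K0 * B ^+ 2 +
  8 * (`|M| * B + K0 * B ^+ 2)).
  have MN0 : 0 <= `|M| * N by exact: mulr_ge0.
  have MB0 : 0 <= `|M| * B by exact: mulr_ge0.
  have KB0 : 0 <= K0 * B ^+ 2 by rewrite mulr_ge0 ?sqr_ge0.
  have : 0 <= `|LN g eps x| by [].
  clear M0; lra.
move=> u gam z u0 g0 t4 tB [s [m [yh [hs hm hyh hz]]]] i.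
rewrite (ger0_norm (M0 i)); move: {M0}(M0 i) => M0.
have hD := centring_error u0 g0 t4 hs hm hyh.
have zR := fl_RN_error e0 u0 g0 t4 hz i.
rewrite -/y -/N in hD.
set t := u + gam in t4 tB hD zR *.
have t0 : 0 <= t by rewrite /t; lra.
have ut : u <= t by rewrite /t; lra.
have t2 := sqr_ge0 t.
pose D := yh - y.
have DE k : D 0 k = yh 0 k - y 0 k by rewrite !mxE.
have tN : (t + 3 * t ^+ 2) * N <= t * (2 * N).
  by rewrite mulrA ler_wpM2r //; nra.
have nD : `|D| <= u * `|y| + (t + 3 * t ^+ 2) * N.
  apply: mx_norm_le => [|k j].
    by rewrite addr_ge0 // mulr_ge0 // addr_ge0 // mulr_ge0.
  rewrite (ord1 k) DE (le_trans (hD j)) // lerD2r ler_wpM2l //.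
  exact: mx_entry_le_norm.
have nDB : `|D| <= t * B.
  rewrite (le_trans nD) // /B [leRHS]mulrDr lerD // ler_wpM2r //.
have D1 : `|D| <= 1 by exact: le_trans tB.
have TD := taylor D D1.
have yD : y + D = yh by rewrite /D addrC subrK.
rewrite yD in TD.
set lin := (X in M * (X + t * N)).
have lin0 : 0 <= lin by rewrite /lin; case: ifP => // _; rewrite mulr_ge0.
have linE : `|(D *m A) 0 i| <= M * (lin + (t + 3 * t ^+ 2) * N).
  (* If y_i = 0, row i of the Jacobian is (g_i / rho) e_i. *)
  rewrite /lin; case: eqP => [yi0|_].
    rewrite add0r mulmx_RN_jacobian yi0 !mul0r subr0 mulrCA mulrC normrM ler_pM //.
      have := entry_le_opnorm_oo A^T i i; rewrite [A^T i i]mxE [A i i]mxE.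
      by rewrite eqxx yi0 !mul0r subr0 mul1r.
    by rewrite DE (le_trans (hD i)) // yi0 normr0 mulr0 add0r.
  apply: (@le_trans _ _ (M * `|D|)); last by rewrite ler_wpM2l.
  have := mulmx_opnorm_oo A^T D^T; rewrite -trmx_mul !norm_trmx.
  by apply: le_trans; exact: mx_entry_le_norm.
have linB : lin + (t + 3 * t ^+ 2) * N <= t * B.
  rewrite /B [leRHS]mulrDr lerD // /lin; case: ifP => _; first by rewrite mulr_ge0.
  by rewrite ler_wpM2r.
set r := LN g eps x 0 i; set r' := RN g eps yh 0 i in zR.
have rem : `|r' - r - (D *m A) 0 i| <= K0 * (t * B) ^+ 2.
  apply: (@le_trans _ _ `|RN g eps yh - RN g eps y - D *m A|).
    have := mx_entry_le_norm (RN g eps yh - RN g eps y - D *m A) 0 i.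
    by rewrite [(_ - D *m A) _ _]mxE [(RN g eps yh - _) _ _]mxE
      [(- RN g eps y) _ _]mxE [(- (D *m A)) _ _]mxE.
  apply: (le_trans TD); rewrite ler_wpM2l // lerXn2r ?nnegrE // mulr_ge0 //.
have rr1 : `|r' - r| <= M * (lin + (t + 3 * t ^+ 2) * N) + K0 * (t * B) ^+ 2.
  rewrite -(subrK ((D *m A) 0 i) (r' - r)) (le_trans (ler_normD _ _)) //.
  by rewrite addrC lerD.
have KB0 : 0 <= K0 * B ^+ 2 by rewrite mulr_ge0 ?sqr_ge0.
have MB0 : 0 <= M * B by rewrite mulr_ge0.
have rr2 : `|r' - r| <= t * (M * B + K0 * B ^+ 2).
  apply: (le_trans rr1); rewrite [leRHS]mulrDr lerD //.
    by rewrite [leRHS]mulrCA ler_wpM2l.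
  rewrite exprMn mulrCA ler_wpM2r //; nra.
have nr : `|r| <= `|LN g eps x| by exact: mx_entry_le_norm.
move: zR; set c := (X in _ <= X * _ -> _) => zR.
have c0 : 0 <= c by rewrite /c !addr_ge0 // mulr_ge0 //; lra.
have c8 : c <= 8 * t.
  have : t ^+ 2 <= t / 4 by nra.
  rewrite /c /t; lra.
set Q := M * B + K0 * B ^+ 2 in rr2 *.
have cE : c * `|r' - r| <= 8 * t * (t * Q) by rewrite ler_pM.
(* The RN error is relative to [r'], the exact RN of the computed centred vector; passing to [r]
   costs only a second-order term. *)
have cr : c * `|r'| <= c * `|r| + c * `|r' - r|.
  by rewrite -mulrDr ler_wpM2l // -{1}(subrK r r') addrC ler_normD.
have r16 : 16 * t ^+ 2 * `|r| <= 16 * t ^+ 2 * `|LN g eps x|.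
  by rewrite ler_wpM2l // mulr_ge0.
rewrite -(subrK r' (z 0 i)) -addrA (le_trans (ler_normD _ _)) //.
apply: (le_trans (lerD (le_trans zR cr) rr1)).
have -> : c * `|r| = (7 / 2 * u + 1 / 2 * gam) * `|r| + 16 * t ^+ 2 * `|r|.
  by rewrite /c; ring.
rewrite exprMn; lra.
Qed.

End LN_error.

(** * Positivity, asymptotics in the unit round-off, and the final bounds *)

Lemma opnorm_oo_jacobian_RN_gt0 (R : realType) d (g : 'rV[R]_d) eps
    (y : 'rV[R]_d) (i : 'I_d) : g 0 i != 0 -> 0 < eps ->
  0 < opnorm_oo ('J (RN g eps) y)^T.
Proof.
move=> gi0 e0; rewrite (jacobian_RN g y e0).
apply: lt_le_trans (entry_le_opnorm_oo _ i i).
rewrite normr_gt0 [X in X != 0]mxE [X in X != 0]mxE eqxx mulf_neq0 //.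
set S := sqnorm2 y + eps.
have S0 : 0 < S by rewrite /S ltr_wpDl ?sqnorm2_ge0.
have r0 : 0 < Num.sqrt S by rewrite sqrtr_gt0.
have yS : y 0 i * y 0 i < S.
  rewrite /S /sqnorm2 (bigD1 i) //= -expr2 -addrA ltrDl ltr_wpDl //.
  by apply: sumr_ge0 => j _; exact: sqr_ge0.
(* The diagonal entry of the Jacobian is non-zero because [eps > 0] makes [S] strictly larger than
   the square of [y 0 i]. *)
have -> : 1%:R / Num.sqrt S - y 0 i * y 0 i / Num.sqrt S ^+ 3 =
    (S - y 0 i * y 0 i) / Num.sqrt S ^+ 3.
  by rewrite -[X in _ = (X - _) / _](sqr_sqrtr (ltW S0)); field; rewrite gt_eqF.
by rewrite gt_eqF // divr_gt0 ?subr_gt0 ?exprn_gt0.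
Qed.

Lemma RN_eq0 (R : realType) d (g : 'rV[R]_d) eps (y : 'rV[R]_d) i :
  g 0 i != 0 -> 0 < eps -> (RN g eps y 0 i == 0) = (y 0 i == 0).
Proof.
move=> gi0 e0; rewrite mxE !mulf_eq0 (negPf gi0) invr_eq0 sqrtr_eq0.
by rewrite leNgt ltr_wpDl ?sqnorm2_ge0 //= orbF.
Qed.

Lemma bigO_sqr_addl (R : realType) (K : R) (gam : R -> R) :
  gam =O_ ((0 : R)^'+) (fun u : R => u) ->
  (fun u => K * (u + gam u) ^+ 2) =O_ ((0 : R)^'+) (fun u : R => u ^+ 2).
Proof.
move=> /eqO_exP[C C0 gC]; apply/eqO_exP.
exists (`|K| * (1 + C) ^+ 2 + 1).
  by rewrite ltr_wpDl // mulr_ge0 ?sqr_ge0.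
have C1 : 0 <= 1 + C by rewrite addr_ge0 // ltW.
near=> u.
have gu : `|gam u| <= C * `|u| by near: u.
have h : `|u + gam u| <= (1 + C) * `|u|.
  by rewrite (le_trans (ler_normD _ _)) // mulrDl mul1r lerD.
rewrite normrM !normrX mulrDl mul1r ler_wpDr ?exprn_ge0 //.
rewrite -mulrA ler_wpM2l // -exprMn lerXn2r ?nnegrE //; exact: mulr_ge0.
Unshelve. all: by end_near. Qed.

Theorem theorem3p3 (R : realType) (d : nat) (g : 'rV[R]_d) (eps : R)
    (gammaMM : nat -> R -> R) :
  (forall i, g 0 i != 0) ->
  0 < eps ->
  (\forall u \near (0 : R)^'+, 0 <= gammaMM d u) ->
  gammaMM d =O_ ((0 : R)^'+) (fun u : R => u) ->
  forall x : 'rV[R]_d,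
  (exists2 h : R -> R, h =O_ ((0 : R)^'+) (fun u : R => u ^+ 2) &
    \forall u \near (0 : R)^'+,
      forall z : 'rV[R]_d, fl_RN u (gammaMM d u) g eps x z ->
      forall i, `|z 0 i - RN g eps x 0 i| <=
        (7 / 2 * u + 1 / 2 * gammaMM d u + h u) * `|RN g eps x 0 i|) /\
  (let y := mean_center x in
   y != 0 ->
   exists2 h : R -> R, h =O_ ((0 : R)^'+) (fun u : R => u ^+ 2) &
    \forall u \near (0 : R)^'+,
      forall z : 'rV[R]_d, fl_LN u (gammaMM d u) g eps x z ->
      forall i, `|z 0 i - LN g eps x 0 i| <=
        (7 / 2 * u + 1 / 2 * gammaMM d u + h u) * `|LN g eps x 0 i| +
        cond_oo (RN g eps) y *
          (u + (u + gammaMM d u) * (norm1 x / (d%:R * `|y|))) *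
          `|LN g eps x|).
Proof.
move=> g0 e0 gam0 gamO x; set gam := gammaMM d in gam0 gamO *.
have [C C0 gC] := (eqO_exP _ _ _).1 gamO.
have C1 : 0 < 1 + C by exact: addr_gt0.
(* Every smallness condition below has the form [(1 + C) * u <= c], where [1 + C] also controls
   [u + gam u]. *)
have small c : 0 < c -> \forall u \near (0 : R)^'+,
    [/\ 0 < u, 0 <= gam u, u + gam u <= (1 + C) * u & (1 + C) * u <= c].
  move=> c0; near=> u.
  have u0 : 0 < u by near: u; exact: nbhs_right_gt.
  have gu0 : 0 <= gam u by near: u.
  have gu : `|gam u| <= C * `|u| by near: u.
  split => //.
    by move: gu; rewrite !ger0_norm ?(ltW u0) // mulrDl mul1r lerD2l.
  rewrite mulrC -ler_pdivlMr //; near: u; apply: nbhs_right_le.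
  by rewrite divr_gt0.
have quarter : 0 < 1 / 4 :> R by lra.
split.
  exists (fun u => 16 * (u + gam u) ^+ 2); first exact: bigO_sqr_addl.
  near=> u => z zP i.
  have [u0 gu0 h1 h2] : [/\ 0 < u, 0 <= gam u, u + gam u <= (1 + C) * u &
    (1 + C) * u <= 1 / 4] by near: u; exact: small.
  exact: fl_RN_error e0 (ltW u0) gu0 (le_trans h1 h2) zP i.
move=> y y0.
have [K K0 KP] := fl_LN_error g x e0.
set N := norm1 x / d%:R in KP; set M := opnorm_oo _ in KP.
have N0 : 0 <= N by rewrite mulr_ge0 ?invr_ge0 ?sumr_ge0.
have ny0 : 0 < `|y| by rewrite normr_gt0.
(* A non-zero entry gives [d > 0], [M > 0] and a non-zero LN, so the condition number has a non-zero
   denominator. *)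
have [j yj0] : exists j, y 0 j != 0.
  apply/existsP; apply: contraNT y0; rewrite negb_exists => /forallP yi0.
  by apply/eqP/rowP => j; rewrite [RHS]mxE; apply/eqP; rewrite -[_ == _]negbK yi0.
have M0 : 0 < M by exact: opnorm_oo_jacobian_RN_gt0 (g0 j) e0.
have nLN0 : 0 < `|LN g eps x|.
  rewrite normr_gt0; apply: contraNneq yj0 => LN0.
  by rewrite -(RN_eq0 y (g0 j) e0) -/(LN g eps x) LN0 mxE.
(* [Q] turns an absolute remainder into a relative one: [Q] times any non-zero entry of LN is at
   least 1 in absolute value. Zero entries add nothing to [Q], as the inverse of 0 is 0. *)
pose Q := \sum_i `|LN g eps x 0 i|^-1.
exists (fun u => K * Q * (u + gam u) ^+ 2); first exact: bigO_sqr_addl.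
have B0 : 0 < `|y| + 2 * N by rewrite ltr_pwDl // mulr_ge0.
have KC0 : 0 < K * (1 + C) + 1 by rewrite ltr_wpDl // mulr_ge0 // ltW.
near=> u => z zP i.
have [u0 gu0 h1 h2] : [/\ 0 < u, 0 <= gam u, u + gam u <= (1 + C) * u &
  (1 + C) * u <= 1 / 4] by near: u; exact: small.
have [_ _ _ h3] : [/\ 0 < u, 0 <= gam u, u + gam u <= (1 + C) * u &
  (1 + C) * u <= (`|y| + 2 * N)^-1] by near: u; apply: small; rewrite invr_gt0.
have [_ _ _ h4] : [/\ 0 < u, 0 <= gam u, u + gam u <= (1 + C) * u &
  (1 + C) * u <= M * `|y| / (K * (1 + C) + 1)].
  by near: u; apply: small; rewrite divr_gt0 // mulr_gt0.
set t := u + gam u in h1 KP *.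
have t0 : 0 <= t by rewrite /t addr_ge0 // ltW.
have tB : t * (`|y| + 2 * N) <= 1.
  by rewrite -ler_pdivlMr // mul1r (le_trans h1).
have := KP u (gam u) z (ltW u0) gu0 (le_trans h1 h2) tB zP i.
rewrite -/y -/M => /le_trans; apply.
(* The norm of LN cancels against the denominator of the condition number. *)
have -> : cond_oo (RN g eps) y *
    (u + t * (norm1 x / (d%:R * `|y|))) * `|LN g eps x| = M * (u * `|y| + t * N).
  rewrite /cond_oo -/M -/(LN g eps x) /N; field.
  by rewrite !gt_eqF // ltr0n (leq_ltn_trans _ (ltn_ord j)).
rewrite -[leLHS]addrA [X in _ <= X + _]mulrDl -[leRHS]addrA lerD2l.
case: eqP => [yi0|/eqP yi0].
  have -> : LN g eps x 0 i = 0 by apply/eqP; rewrite (RN_eq0 _ (g0 i) e0); exact/eqP.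
  rewrite normr0 mulr0 !add0r mulrDr addrC lerD2r.
  apply: (@le_trans _ _ ((K * (1 + C) + 1) * ((1 + C) * u) * u)).
    rewrite expr2 mulrA; apply: (@le_trans _ _ (K * ((1 + C) * u) * ((1 + C) * u))).
      by rewrite ler_pM ?mulr_ge0 // ler_wpM2l.
    rewrite (_ : K * _ * _ = (K * (1 + C)) * ((1 + C) * u) * u); last by ring.
    rewrite !ler_wpM2r ?(ltW u0) ?lerDl //.
    by rewrite mulr_ge0 // ltW.
  rewrite [leRHS]mulrCA [leRHS]mulrC ler_wpM2r ?(ltW u0) //.
  by rewrite mulrC -ler_pdivlMr.
have LNi0 : 0 < `|LN g eps x 0 i| by rewrite normr_gt0 (RN_eq0 _ (g0 i) e0).
have Q1 : 1 <= Q * `|LN g eps x 0 i|.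
  rewrite -ler_pdivrMr // mul1r /Q (bigD1 i) //= lerDl.
  by apply: sumr_ge0 => k _; rewrite invr_ge0.
rewrite addrC lerD2r (_ : K * Q * t ^+ 2 * _ =
  K * t ^+ 2 * (Q * `|LN g eps x 0 i|)); last by ring.
by rewrite ler_peMr // mulr_ge0 // sqr_ge0.
Unshelve. all: by end_near. Qed.
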